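(* Consider the constrained multi-objective problem (MOP) described in the context and apply the trust-region filter algorithm described in the context, under the standing assumptions (A1)–(A8) listed there. Suppose that $\{x^{(k)}\}$ is a quasi-stationary subsequence of the iterates produced by the algorithm, with limit point $\bar x$, i.e. along this subsequence $x^{(k)}\to\bar x$, $\theta_k\to\theta(\bar x)=0$, $\chi^{(k)}\to0$ and $\Delta_{(k)}\to0$. If the Mangasarian–Fromovitz constraint qualification holds at $\bar x$, then $\bar x$ is a KKT-point of (MOP).
   Context: **Problem.** Let $f=(f_1,\dots,f_K):\mathbb{R}^n\to\mathbb{R}^K$, $h=(h_1,\dots,h_M):\mathbb{R}^n\to\mathbb{R}^M$, $g=(g_1,\dots,g_P):\mathbb{R}^n\to\mathbb{R}^P$ be twice continuously differentiable. (MOP) is: $\min_x f(x)$ (in the Pareto sense) subject to $h(x)=0$, $g(x)\le 0$. A feasible point $\bar x$ is a *KKT-point* of (MOP) if there are $\lambda\in\mathbb R^K$, $\lambda\ge0$, $\sum_\ell\lambda_\ell=1$, $\mu'\in\mathbb R^M$ and $\nu\in\mathbb R^P$, $\nu\ge0$, with $\sum_\ell\lambda_\ell\nabla f_\ell(\bar x)+\sum_\ell\mu'_\ell\nabla h_\ell(\bar x)+\sum_\ell\nu_\ell\nabla g_\ell(\bar x)=0$ and $\nu_\ell g_\ell(\bar x)=0$ for all $\ell$. The *Mangasarian–Fromovitz constraint qualification* (MFCQ) holds at $\bar x$ if the gradients $\nabla h_1(\bar x),\dots,\nabla h_M(\bar x)$ are linearly independent and there is $d\in\mathbb R^n$ with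 $\langle\nabla h_\ell(\bar x),d\rangle=0$ for all $\ell$ and $\langle\nabla g_\ell(\bar x),d\rangle<0$ for all $\ell$ with $g_\ell(\bar x)=0$. Put $\Phi(x)=\max_{\ell} f_\ell(x)$ and $\theta(x)=\max\{0,\max_\ell|h_\ell(x)|,\max_\ell g_\ell(x)\}$; write $\theta_k=\theta(x^{(k)})$. **Models, trust regions, subproblems.** In iteration $k$ there are norms $\|\cdot\|_{\mathrm{tr},k}$ (trust-region norm) and $\|\cdot\|_k$ (problem norm) on $\mathbb{R}^n$, a preliminary radius $\bar\Delta_{(k)}$ and a final radius $\Delta_{(k)}\le\bar\Delta_{(k)}$; $B(x^{(k)};\Delta)=\{x:\|x-x^{(k)}\|_{\mathrm{tr},k}\le\Delta\}$, $B^{(k)}=B(x^{(k)};\Delta_{(k)})$, and $\mathcal C=\bigcup_{k}B(x^{(k)};\bar\Delta_{(k)})$. Surrogate models $\hat f^{(k)},\hat g^{(k)},\hat h^{(k)}$ of $f,g,h$ are used, with $\Phi^{(k)}(x)=\max_\ell\hat f^{(k)}_\ell(x)$ and Jacobians $\hat F_k,\hat G_k,\hat H_k$. The approximate linearized feasible set is $$\mathcal L_k=\{x^{(k)}+s:\ \hat h^{(k)}(x^{(k)})+\hat H_k(x^{(k)})s=0,\ \hat g^{(k)}(x^{(k)})+\hat G_k(x^{(k)})s\le 0\}.$$ The normal step $n^{(k)}$ is the minimizer of $\|n\|_2^2$ subject to $n\in\mathcal L_k-x^{(k)}$ (it exists iff $\mathcal L_k\neq\emptyset$); $x^{(k)}_{\mathrm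 n}=x^{(k)}+n^{(k)}$. With constants $c_\Delta\in(0,1)$, $c_\mu>0$, $\mu\in(0,1)$, a normal step $n$ is *compatible* for a radius $\Delta$ if $\|n\|_{\mathrm{tr},k}\le c_\Delta\Delta\min\{1,c_\mu\Delta^\mu\}$. The tangential problem is $$\omega(x_{\mathrm n}^{(k)};\hat f^{(k)},\mathcal L_k,\|\cdot\|)=-\min_{\beta\in\mathbb R,\,d\in\mathbb R^n}\beta\ \text{ s.t. }\ \hat F_k(x_{\mathrm n}^{(k)})d\le\beta\ (\text{componentwise}),\ d\in\mathcal L_k-x_{\mathrm n}^{(k)},\ \|d\|\le1 .$$ Its value for $\|\cdot\|=\|\cdot\|_k$ is $\hat\omega^{(k)}$ and for $\|\cdot\|=\|\cdot\|_2$ it is $\hat\omega^{(k)}_2$. The criticality measure is $\min\{1,\hat\omega^{(k)}\}$, called $\bar\chi^{(k)}$ before the Criticality Routine and $\chi^{(k)}$ after it (with the final models). **Filter.** A filter $\mathcal F$ is a finite set of pairs $(\theta_j,\Phi_j)$; with a fixed $\gamma_\theta\in(0,1)$, a point $x$ is acceptable for $\mathcal F$ iff for all $(\theta_j,\Phi_j)\in\mathcal F$: $\theta(x)\le(1-\gamma_\theta)\theta_j$ or $\Phi(x)\le\Phi_j-\gamma_\theta\theta_j$. Adding $x$ to the filter means adding $(\theta(x),\Phi(x))$ and removing all pairs with $\theta_j\ge\theta(x)$ and $\Phi_j-\gamma_\theta\theta_j\ge\Phi(x)-\gamma_\theta\theta(x)$. **Parameters.** $0<\Delta_{(0)}\le\Delta_{\max}<\infty$;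 $0<\gamma_0\le\gamma_1<1\le\gamma_2$; $0<\nu_1\le\nu_0<1$; $0<\varepsilon_\chi<1$; $0<\varepsilon_\theta\le\delta_{\mathrm n}$; $\kappa_\theta\in(0,1)$; $\psi>\frac1{1+\mu}$; $0<\mathtt B<\mathtt M$; $\alpha\in(0,1)$. **Algorithm.** Step 0: $k=0$, $\mathcal F=\emptyset$, $n^{(0)}=$ undefined, $\bar\Delta_{(0)}:=\Delta_{(0)}$; build models fully linear on $B(x^{(0)};\bar\Delta_{(0)})$. Step 1 (compatibility test): if $n^{(k)}$ is undefined, try to compute it. If $n^{(k)}$ exists and is compatible for $\bar\Delta_{(k)}$, go to step 3; otherwise go to step 2. Step 2 (restoration): add $x^{(k)}$ to $\mathcal F$, set $\Delta_{(k)}=\bar\Delta_{(k)}$, and attempt to find a step $r^{(k)}$ and $\bar\Delta_{(k+1)}>0$ such that $x^{(k)}+r^{(k)}$ is acceptable for $\mathcal F$ and the normal step at $x^{(k)}+r^{(k)}$ exists and is compatible for $\bar\Delta_{(k+1)}$; set $x^{(k+1)}=x^{(k)}+r^{(k)}$ and go to step 8. (The restoration works on $\min_x\theta(x)$; it is assumed that it either succeeds or fails by converging to an infeasible first-order critical point of $\min_x\theta(x)$.) Step 3: compute a minimizer $d^{(k)}$ of the tangential problem with norm $\|\cdot\|_k$, and $\bar\chi^{(k)}$. Step 4 (criticality test): if $\theta_k<\varepsilon_\theta$, $\bar\chi^{(k)}<\varepsilon_\chi$ and $\bar\Delta_{(k)}>\mathtt M\bar\chi^{(k)}$, run the Criticality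 Routine (below) to obtain $\Delta_{(k)},\chi^{(k)}$ and updated models, $n^{(k)}$, $d^{(k)}$. Else set $\Delta_{(k)}=\bar\Delta_{(k)}$, $\chi^{(k)}=\bar\chi^{(k)}$. Step 5 (acceptance test): compute a step size $\sigma_{(k)}$ as in (A7) and put $s^{(k)}=n^{(k)}+\sigma_{(k)}d^{(k)}$, $x_{\mathrm s}^{(k)}=x^{(k)}+s^{(k)}$, $\rho^{(k)}=\frac{\Phi(x^{(k)})-\Phi(x_{\mathrm s}^{(k)})}{\Phi^{(k)}(x^{(k)})-\Phi^{(k)}(x_{\mathrm s}^{(k)})}$. If $x_{\mathrm s}^{(k)}$ is not acceptable for $\mathcal F\cup\{(\theta_k,\Phi(x^{(k)}))\}$, or if both $$(\ast)\quad\Phi^{(k)}(x^{(k)})-\Phi^{(k)}(x_{\mathrm s}^{(k)})\ge\kappa_\theta\theta_k^\psi$$ and $\rho^{(k)}<\nu_1$ hold, then set $x^{(k+1)}=x^{(k)}$, $n^{(k+1)}=n^{(k)}$, choose $\bar\Delta_{(k+1)}\in[\gamma_0\Delta_{(k)},\gamma_1\Delta_{(k)}]$ and go to step 8. Step 6: if $(\ast)$ fails, add $x^{(k)}$ to $\mathcal F$. Step 7: set $x^{(k+1)}=x_{\mathrm s}^{(k)}$ and choose $\bar\Delta_{(k+1)}\in[\gamma_0\Delta_{(k)},\gamma_1\Delta_{(k)}]$ if $\rho^{(k)}<\nu_0$ and $\bar\Delta_{(k+1)}\in[\Delta_{(k)},\min\{\gamma_2\Delta_{(k)},\Delta_{\max}\}]$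 if $\rho^{(k)}\ge\nu_0$. Step 8: update the models for $x^{(k+1)}$ and $\bar\Delta_{(k+1)}$; set $n^{(k+1)}$ to undefined if the iterate changed or if the models depend on the radius; $k\leftarrow k+1$; go to step 1. **Criticality Routine** (at $x^{(k)}$). Start with $j=0$, $\delta_0=\bar\Delta_{(k)}$, $\chi_0=\bar\chi^{(k)}$, $n_0=n^{(k)}$. While $\delta_j>\mathtt M\chi_j$: let $\delta_j^+=\alpha\delta_j$; make the models fully linear for radius $\delta_j^+$; compute the normal step $n_j^+$ for the new models; if $n_j^+$ is not compatible for $\delta_j^+$, break; otherwise $j\leftarrow j+1$, $\delta_j=\delta_{j-1}^+$, $n_j=n_{j-1}^+$, and solve the tangential problem for the new models to get the criticality measure $\chi_j$. After the loop, keep the updated models, set $\chi^{(k)}=\chi_j$, $n^{(k)}=n_j$ and $\Delta_{(k)}=\min\{\max\{\delta_j,\mathtt B\chi^{(k)}\},\bar\Delta_{(k)}\}$. **Conventions.** If in some iteration $k$ the Criticality Routine runs infinitely, the quasi-stationary sequence considered is the inner sequence $j\to\infty$ with constant point $x^{(k)}$, normal steps $n_j$, radii $\delta_j$ and measures $\chi_j$. The indices of a quasi-stationary subsequence are indices of iterations in which the criticality measure $\chi^{(k)}$ is computed (i.e. that are not restoration iterations). **Assumptions.** (A1) For all $k$: $0<\Delta_{(k)}\le\bar\Delta_{(k)}<\Delta_{\max}$, and all functions and models are defined on $\mathcal C$. (A2) All $f_\ell,g_\ell,h_\ell$ are twice continuously differentiable on an open set containing $\mathcal C$ and have Lipschitz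 continuous gradients on $\mathcal C$. (A3) A model $\hat\varphi$ of $\varphi$ is *fully linear* on $B(x;\Delta)$ with constants $\mathtt e,\dot{\mathtt e},L>0$ if $\nabla\hat\varphi$ is Lipschitz with constant at most $L$ and, for all $\xi\in B(x;\Delta)\cap\mathcal C$, $\|\nabla\varphi(\xi)-\nabla\hat\varphi(\xi)\|_2\le\dot{\mathtt e}\Delta$ and $|\varphi(\xi)-\hat\varphi(\xi)|\le\mathtt e\Delta^2$. There are constants independent of $k$ such that all models used at $x^{(k)}$ are fully linear for the radius they are built for ($\bar\Delta_{(k)}$ before, $\delta_j$ within, $\Delta_{(k)}$ after the Criticality Routine); the constants are so large that $L+L^{\varphi}\le\mathtt e$ and $\dot{\mathtt e}/2\le\mathtt e$, where $L^\varphi$ is a Lipschitz constant of $\nabla\varphi$. All models interpolate at $x^{(k)}$, i.e. $\hat\varphi(x^{(k)})=\varphi(x^{(k)})$. Models with these properties can be constructed in finitely many steps for any $\Delta\in(0,\Delta_{\max}]$. (A4) There are $\delta_{\mathrm n}>0$, $c_{\mathrm{ubn}}>0$ such that if $\theta_k\le\delta_{\mathrm n}$ then the normal step $n$ exists (for any of the models used at $x^{(k)}$) and $\|n\|_{\mathrm{tr},k}\le c_{\mathrm{ubn}}\theta_k$. (A5) There is $\mathsf c\ge1$ such that for all $k$, all $x\in\mathbb R^n$ and $\|\cdot\|_*\in\{\|\cdot\|_{\mathrm{tr},k},\|\cdot\|_k\}$: $\frac1{\mathsf c}\|x\|_*\le\|x\|_2\le\mathsf c\|x\|_*$. (A6)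 There is $\mathtt H>0$ such that for all $k$, $\ell$ and all $\xi\in\mathcal L_k\cap B^{(k)}$, the Hessian of $\hat f^{(k)}_\ell$ satisfies $\|\nabla^2\hat f^{(k)}_\ell(\xi)\|_2\le\mathtt H$. (A7) There are constants $c_{\mathrm{sd}}\in(0,1)$, $\mathtt W\ge1$ such that, whenever $n^{(k)}$ is compatible and $d^{(k)}$ is a minimizer of the tangential problem with norm $\|\cdot\|_k$, there is (and the algorithm uses) a step length $\sigma_{(k)}\ge0$ with $x_{\mathrm n}^{(k)}+\sigma_{(k)}d^{(k)}\in\mathcal L_k\cap B^{(k)}$ and $\Phi^{(k)}(x_{\mathrm n}^{(k)})-\Phi^{(k)}(x_{\mathrm n}^{(k)}+\sigma_{(k)}d^{(k)})\ge c_{\mathrm{sd}}\,\hat\omega_2^{(k)}\min\{\hat\omega_2^{(k)}/\mathtt W,\Delta_{(k)},1\}$. (A8) $\mathcal C$ is contained in a closed and bounded set. *)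

(* Defs.v *)
From HB Require Import structures.
From mathcomp Require Import all_boot all_order all_algebra.
From mathcomp Require Import all_classical all_reals all_analysis.

Set Implicit Arguments.
Unset Strict Implicit.
Unset Printing Implicit Defensive.

Import Order.TTheory GRing.Theory Num.Theory.
Import numFieldNormedType.Exports.

Local Open Scope classical_set_scope.
Local Open Scope ring_scope.

Definition dotp (R : realType) (n : nat) (u v : 'rV[R]_n) : R :=
  \sum_(i < n) u 0 i * v 0 i.

(* The library norm of 'rV[R]_n is the sup norm; it is used below only for its
   topology. *)
Definition enorm (R : realType) (n : nat) (u : 'rV[R]_n) : R :=
  Num.sqrt (dotp u u).

Definition opnorm2 (R : realType) (n : nat) (A : 'M[R]_n) : R :=
  sup [set enorm (v *m A) | v in [set v : 'rV[R]_n | enorm v <= 1]].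

Definition is_norm (R : realType) (n : nat) (N : 'rV[R]_n -> R) : Prop :=
  [/\ forall u v, N (u + v) <= N u + N v,
      forall (a : R) u, N (a *: u) = `|a| * N u
    & forall u, N u = 0 -> u = 0].

Definition grad (R : realType) (n : nat) (f : 'rV[R]_n -> R) (x : 'rV[R]_n) :
    'rV[R]_n :=
  \row_(i < n) 'D_(delta_mx 0 i) f x.

Definition hess (R : realType) (n : nat) (f : 'rV[R]_n -> R) (x : 'rV[R]_n) :
    'M[R]_n :=
  \matrix_(i < n, j < n) 'D_(delta_mx 0 j) (fun y => grad f y 0 i) x.

Definition C1_on (R : realType) (n : nat) (U : set 'rV[R]_n)
    (f : 'rV[R]_n -> R) : Prop :=
  forall x, U x -> differentiable f x /\ {for x, continuous (grad f)}.

(* Meaningful for open U: the derivatives are those of the total function. *)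
Definition C2_on (R : realType) (n : nat) (U : set 'rV[R]_n)
    (f : 'rV[R]_n -> R) : Prop :=
  C1_on U f /\ forall i : 'I_n, C1_on U (fun y => grad f y 0 i).

Definition twice_differentiable (R : realType) (n : nat) (f : 'rV[R]_n -> R)
    (x : 'rV[R]_n) : Prop :=
  (\forall y \near x, differentiable f y) /\
  forall i : 'I_n, differentiable (fun y => grad f y 0 i) x.

Definition lipschitz_grad (R : realType) (n : nat) (L : R) (A : set 'rV[R]_n)
    (f : 'rV[R]_n -> R) : Prop :=
  forall x y, A x -> A y -> enorm (grad f x - grad f y) <= L * enorm (x - y).

(* Objectives, equality and inequality constraints; used both for the problem
   (f, h, g) and for a surrogate of it. *)
Record functions (R : realType) (n K M P : nat) := Functions {
  obj : 'I_K.+1 -> 'rV[R]_n -> R;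
  eqc : 'I_M -> 'rV[R]_n -> R;
  ineq : 'I_P -> 'rV[R]_n -> R }.

Definition each (R : realType) (n K M P : nat) (Q : ('rV[R]_n -> R) -> Prop)
    (F : functions R n K M P) : Prop :=
  [/\ forall l, Q (obj F l), forall l, Q (eqc F l) & forall l, Q (ineq F l)].

Definition each2 (R : realType) (n K M P : nat)
    (Q : ('rV[R]_n -> R) -> ('rV[R]_n -> R) -> Prop)
    (F m : functions R n K M P) : Prop :=
  [/\ forall l, Q (obj F l) (obj m l), forall l, Q (eqc F l) (eqc m l)
    & forall l, Q (ineq F l) (ineq m l)].

Definition maxobj (R : realType) (n K M P : nat) (F : functions R n K M P)
    (x : 'rV[R]_n) : R :=
  \big[Num.max/obj F ord0 x]_(l < K.+1) obj F l x.

Definition theta (R : realType) (n K M P : nat) (F : functions R n K M P)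
    (x : 'rV[R]_n) : R :=
  Num.max (\big[Num.max/0]_(l < M) `|eqc F l x|) (\big[Num.max/0]_(l < P) ineq F l x).

Definition feasible (R : realType) (n K M P : nat) (F : functions R n K M P)
    (x : 'rV[R]_n) : Prop :=
  (forall l, eqc F l x = 0) /\ (forall l, ineq F l x <= 0).

Definition KKT_point (R : realType) (n K M P : nat) (F : functions R n K M P)
    (x : 'rV[R]_n) : Prop :=
  feasible F x /\
  exists (lam : 'I_K.+1 -> R) (mu : 'I_M -> R) (nu : 'I_P -> R),
    [/\ forall l, 0 <= lam l,
        \sum_l lam l = 1,
        forall l, 0 <= nu l,
        \sum_l lam l *: grad (obj F l) x + \sum_l mu l *: grad (eqc F l) x
          + \sum_l nu l *: grad (ineq F l) x = 0
      & forall l, nu l * ineq F l x = 0].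

Definition MFCQ (R : realType) (n K M P : nat) (F : functions R n K M P)
    (x : 'rV[R]_n) : Prop :=
  row_free (\matrix_(l < M) grad (eqc F l) x) /\
  exists d : 'rV[R]_n,
    (forall l, dotp (grad (eqc F l) x) d = 0) /\
    (forall l, ineq F l x = 0 -> dotp (grad (ineq F l) x) d < 0).

Definition lin_set (R : realType) (n K M P : nat) (m : functions R n K M P)
    (x : 'rV[R]_n) : set 'rV[R]_n :=
  [set x + s | s in
    [set s | (forall l, eqc m l x + dotp (grad (eqc m l) x) s = 0) /\
             (forall l, ineq m l x + dotp (grad (ineq m l) x) s <= 0)]].

Definition normal_step (R : realType) (n K M P : nat) (m : functions R n K M P)
    (x s : 'rV[R]_n) : Prop :=
  lin_set m x (x + s) /\
  forall s', lin_set m x (x + s') -> enorm s ^+ 2 <= enorm s' ^+ 2.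

Definition tangential_feasible (R : realType) (n K M P : nat)
    (m : functions R n K M P) (x xn : 'rV[R]_n) (N : 'rV[R]_n -> R)
    (beta : R) (d : 'rV[R]_n) : Prop :=
  [/\ forall l, dotp (grad (obj m l) xn) d <= beta,
      lin_set m x (xn + d) & N d <= 1].

Definition tangential_minimizer (R : realType) (n K M P : nat)
    (m : functions R n K M P) (x xn : 'rV[R]_n) (N : 'rV[R]_n -> R)
    (d : 'rV[R]_n) : Prop :=
  exists2 beta, tangential_feasible m x xn N beta d
    & forall beta' d', tangential_feasible m x xn N beta' d' -> beta <= beta'.

(* For a norm N the infimum is a minimum as soon as some d is admissible. *)
Definition omega (R : realType) (n K M P : nat) (m : functions R n K M P)
    (x xn : 'rV[R]_n) (N : 'rV[R]_n -> R) : R :=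
  - inf [set beta | exists d, tangential_feasible m x xn N beta d].

Definition crit_measure (R : realType) (n K M P : nat)
    (m : functions R n K M P) (x xn : 'rV[R]_n) (N : 'rV[R]_n -> R) : R :=
  Num.min 1 (omega m x xn N).

Record constants (R : realType) := Constants {
  Delta_init : R; Delta_max : R;
  gamma0 : R; gamma1 : R; gamma2 : R;
  nu0 : R; nu1 : R;
  eps_chi : R; eps_theta : R; delta_n : R;
  kappa_theta : R; psi : R; gamma_theta : R;
  c_Delta : R; c_mu : R; mu_exp : R;
  cB : R; cM : R; alpha : R }.

Definition constants_ok (R : realType) (p : constants R) : Prop :=
  0 < Delta_init p <= Delta_max p /\
  (0 < gamma0 p <= gamma1 p /\ gamma1 p < 1 <= gamma2 p) /\
  (0 < nu1 p <= nu0 p /\ nu0 p < 1) /\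
  0 < eps_chi p < 1 /\
  0 < eps_theta p <= delta_n p /\
  0 < kappa_theta p < 1 /\
  (1 + mu_exp p)^-1 < psi p /\
  0 < gamma_theta p < 1 /\
  0 < c_Delta p < 1 /\
  0 < c_mu p /\
  0 < mu_exp p < 1 /\
  0 < cB p < cM p /\
  0 < alpha p < 1.

(* A filter is a finite list of pairs (theta_j, Phi_j). *)
Definition acceptable (R : realType) (n K M P : nat) (F : functions R n K M P)
    (p : constants R) (fl : seq (R * R)) (x : 'rV[R]_n) : Prop :=
  forall q, q \in fl ->
    theta F x <= (1 - gamma_theta p) * q.1 \/
    maxobj F x <= q.2 - gamma_theta p * q.1.

Definition add_filter (R : realType) (n K M P : nat) (F : functions R n K M P)
    (p : constants R) (x : 'rV[R]_n) (fl : seq (R * R)) : seq (R * R) :=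
  (theta F x, maxobj F x) ::
  [seq q <- fl | ~~ ((theta F x <= q.1) &&
      (maxobj F x - gamma_theta p * theta F x <= q.2 - gamma_theta p * q.1))].

(* The data produced by a run. Iteration k is started for every k if
   [stop = None], and for k <= k0 if [stop = Some k0], where k0 is an iteration
   that is never completed: its Criticality Routine runs infinitely or its
   restoration does not succeed. Entries that a run never computes are
   irrelevant.
   Suffix 0: value before the Criticality Routine (Delta-bar, chi-bar, ...);
   without suffix: final value in the iteration.
   [cr_mod k j] is the model built in the routine for the radius [cr_rad k j],
   so that delta_j^+ and the models and normal step belonging to it are the
   entries of index j.+1. *)
Record run_data (R : realType) (n K M P : nat) := RunData {
  stop : option nat;
  iter_x : nat -> 'rV[R]_n;
  tr_norm : nat -> 'rV[R]_n -> R;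
  pb_norm : nat -> 'rV[R]_n -> R;
  filt : nat -> seq (R * R);
  radius0 : nat -> R;
  radius : nat -> R;
  models0 : nat -> functions R n K M P;
  models : nat -> functions R n K M P;
  nstep0 : nat -> 'rV[R]_n;
  nstep : nat -> 'rV[R]_n;
  tstep0 : nat -> 'rV[R]_n;
  tstep : nat -> 'rV[R]_n;
  chi0 : nat -> R;
  chi : nat -> R;
  sigma : nat -> R;
  cr_rad : nat -> nat -> R;
  cr_mod : nat -> nat -> functions R n K M P;
  cr_nstep : nat -> nat -> 'rV[R]_n;
  cr_tstep : nat -> nat -> 'rV[R]_n;
  cr_chi : nat -> nat -> R }.

Definition started (R : realType) (n K M P : nat) (t : run_data R n K M P)
    (k : nat) : Prop :=
  if stop t is Some k0 then (k <= k0)%N else True.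

Definition completed (R : realType) (n K M P : nat) (t : run_data R n K M P)
    (k : nat) : Prop :=
  if stop t is Some k0 then (k < k0)%N else True.

Definition tr_ball (R : realType) (n K M P : nat) (t : run_data R n K M P)
    (k : nat) (D : R) : set 'rV[R]_n :=
  [set y | tr_norm t k (y - iter_x t k) <= D].

Definition Cset (R : realType) (n K M P : nat) (t : run_data R n K M P) :
    set 'rV[R]_n :=
  \bigcup_(k in [set k | started t k]) tr_ball t k (radius0 t k).

Definition compatible (R : realType) (n K M P : nat) (p : constants R)
    (t : run_data R n K M P) (k : nat) (s : 'rV[R]_n) (D : R) : Prop :=
  tr_norm t k s <= c_Delta p * D * Num.min 1 (c_mu p * D `^ mu_exp p).

Definition compatible_normal_step (R : realType) (n K M P : nat)
    (p : constants R) (t : run_data R n K M P) (k : nat)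
    (m : functions R n K M P) (s : 'rV[R]_n) (D : R) : Prop :=
  normal_step m (iter_x t k) s /\ compatible p t k s D.

(* A normal step carried over from the previous iteration is used only when
   neither the iterate nor the models changed, and is then again the normal
   step of the current models; so no bookkeeping of carried-over steps is
   needed. *)
Definition restoration_iter (R : realType) (n K M P : nat) (p : constants R)
    (t : run_data R n K M P) (k : nat) : Prop :=
  ~ exists s, compatible_normal_step p t k (models0 t k) s (radius0 t k).

Definition criticality_test (R : realType) (n K M P : nat)
    (F : functions R n K M P) (p : constants R) (t : run_data R n K M P)
    (k : nat) : Prop :=
  [/\ theta F (iter_x t k) < eps_theta p, chi0 t k < eps_chi p
    & cM p * chi0 t k < radius0 t k].

Definition cr_guard (R : realType) (n K M P : nat) (p : constants R)
    (t : run_data R n K M P) (k j : nat) : Prop :=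
  cM p * cr_chi t k j < cr_rad t k j.

Definition cr_init (R : realType) (n K M P : nat) (t : run_data R n K M P)
    (k : nat) : Prop :=
  cr_rad t k 0 = radius0 t k /\ cr_mod t k 0 = models0 t k /\
  cr_nstep t k 0 = nstep0 t k /\ cr_tstep t k 0 = tstep0 t k /\
  cr_chi t k 0 = chi0 t k.

(* The pass through the loop body with index j is entered and reaches j.+1. *)
Definition cr_pass (R : realType) (n K M P : nat) (p : constants R)
    (t : run_data R n K M P) (k j : nat) : Prop :=
  let xn := iter_x t k + cr_nstep t k j.+1 in
  [/\ cr_guard p t k j,
      cr_rad t k j.+1 = alpha p * cr_rad t k j,
      compatible_normal_step p t k (cr_mod t k j.+1) (cr_nstep t k j.+1)
        (cr_rad t k j.+1),
      tangential_minimizer (cr_mod t k j.+1) (iter_x t k) xn (pb_norm t k)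
        (cr_tstep t k j.+1)
    & cr_chi t k j.+1 =
        crit_measure (cr_mod t k j.+1) (iter_x t k) xn (pb_norm t k)].

Definition cr_break (R : realType) (n K M P : nat) (p : constants R)
    (t : run_data R n K M P) (k j : nat) : Prop :=
  [/\ cr_guard p t k j,
      cr_rad t k j.+1 = alpha p * cr_rad t k j
    & ~ exists s, compatible_normal_step p t k (cr_mod t k j.+1) s
          (cr_rad t k j.+1)].

(* The model with index j has been built. *)
Definition cr_built (R : realType) (n K M P : nat) (p : constants R)
    (t : run_data R n K M P) (k j : nat) : Prop :=
  (forall i, (i.+1 < j)%N -> cr_pass p t k i) /\
  ((0 < j)%N -> cr_guard p t k j.-1).

(* The routine ends with index j. After a break the surrogate carried on may be
   the one with index j (to which n_j and chi_j belong) or the last one built;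
   both are allowed. *)
Definition cr_ends (R : realType) (n K M P : nat) (p : constants R)
    (t : run_data R n K M P) (k j : nat) : Prop :=
  [/\ forall i, (i < j)%N -> cr_pass p t k i,
      (~ cr_guard p t k j /\ models t k = cr_mod t k j) \/
      (cr_break p t k j /\
       (models t k = cr_mod t k j \/ models t k = cr_mod t k j.+1)),
      nstep t k = cr_nstep t k j /\ tstep t k = cr_tstep t k j,
      chi t k = cr_chi t k j
    & radius t k =
        Num.min (Num.max (cr_rad t k j) (cB p * chi t k)) (radius0 t k)].

Definition cr_endless (R : realType) (n K M P : nat) (F : functions R n K M P)
    (p : constants R) (t : run_data R n K M P) (k : nat) : Prop :=
  [/\ ~ restoration_iter p t k, criticality_test F p t k
    & forall j, cr_pass p t k j].

Definition start_ok (R : realType) (n K M P : nat) (F : functions R n K M P)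
    (p : constants R) (t : run_data R n K M P) (k : nat) : Prop :=
  ~ restoration_iter p t k ->
  let xn := iter_x t k + nstep0 t k in
  [/\ compatible_normal_step p t k (models0 t k) (nstep0 t k) (radius0 t k),
      tangential_minimizer (models0 t k) (iter_x t k) xn (pb_norm t k)
        (tstep0 t k),
      chi0 t k = crit_measure (models0 t k) (iter_x t k) xn (pb_norm t k)
    & criticality_test F p t k -> cr_init t k].

Definition restoration_ok (R : realType) (n K M P : nat)
    (F : functions R n K M P) (p : constants R) (t : run_data R n K M P)
    (k : nat) : Prop :=
  [/\ filt t k.+1 = add_filter F p (iter_x t k) (filt t k),
      radius t k = radius0 t k /\ models t k = models0 t k,
      0 < radius0 t k.+1,
      acceptable F p (filt t k.+1) (iter_x t k.+1)
    & exists s, compatible_normal_step p t k.+1 (models0 t k.+1) s (radius0 t k.+1)].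

Definition criticality_ok (R : realType) (n K M P : nat)
    (F : functions R n K M P) (p : constants R) (t : run_data R n K M P)
    (k : nat) : Prop :=
  (criticality_test F p t k -> exists j, cr_ends p t k j) /\
  (~ criticality_test F p t k ->
    [/\ radius t k = radius0 t k, models t k = models0 t k, nstep t k = nstep0 t k,
        tstep t k = tstep0 t k & chi t k = chi0 t k]).

Definition trial (R : realType) (n K M P : nat) (t : run_data R n K M P)
    (k : nat) : 'rV[R]_n :=
  iter_x t k + (nstep t k + sigma t k *: tstep t k).

Definition model_decrease (R : realType) (n K M P : nat)
    (t : run_data R n K M P) (k : nat) : R :=
  maxobj (models t k) (iter_x t k) - maxobj (models t k) (trial t k).

(* With the convention x / 0 = 0 *)
Definition rho (R : realType) (n K M P : nat) (F : functions R n K M P)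
    (t : run_data R n K M P) (k : nat) : R :=
  (maxobj F (iter_x t k) - maxobj F (trial t k)) / model_decrease t k.

Definition sufficient_decrease (R : realType) (n K M P : nat)
    (F : functions R n K M P) (p : constants R) (t : run_data R n K M P)
    (k : nat) : Prop :=
  kappa_theta p * theta F (iter_x t k) `^ psi p <= model_decrease t k.

Definition rejected (R : realType) (n K M P : nat) (F : functions R n K M P)
    (p : constants R) (t : run_data R n K M P) (k : nat) : Prop :=
  ~ acceptable F p
      ((theta F (iter_x t k), maxobj F (iter_x t k)) :: filt t k) (trial t k)
  \/ (sufficient_decrease F p t k /\ rho F t k < nu1 p).

(* The step size sigma is constrained by A7 only. *)
Definition acceptance_ok (R : realType) (n K M P : nat)
    (F : functions R n K M P) (p : constants R) (t : run_data R n K M P)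
    (k : nat) : Prop :=
  (rejected F p t k ->
    [/\ iter_x t k.+1 = iter_x t k, filt t k.+1 = filt t k
      & gamma0 p * radius t k <= radius0 t k.+1 <= gamma1 p * radius t k]) /\
  (~ rejected F p t k ->
    [/\ iter_x t k.+1 = trial t k,
        sufficient_decrease F p t k -> filt t k.+1 = filt t k,
        ~ sufficient_decrease F p t k ->
          filt t k.+1 = add_filter F p (iter_x t k) (filt t k),
        rho F t k < nu0 p ->
          gamma0 p * radius t k <= radius0 t k.+1 <= gamma1 p * radius t k
      & nu0 p <= rho F t k ->
          radius t k <= radius0 t k.+1 <= Num.min (gamma2 p * radius t k) (Delta_max p)]).

(* If iteration k0 is never completed, either the routine runs infinitely or
   k0 is a restoration iteration whose restoration does not succeed. *)
Definition algorithm_run (R : realType) (n K M P : nat)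
    (F : functions R n K M P) (p : constants R) (t : run_data R n K M P) :
    Prop :=
  [/\ filt t 0 = [::] /\ radius0 t 0 = Delta_init p,
      forall k, started t k ->
        [/\ is_norm (tr_norm t k), is_norm (pb_norm t k) & start_ok F p t k],
      forall k, completed t k -> restoration_iter p t k ->
        restoration_ok F p t k,
      forall k, completed t k -> ~ restoration_iter p t k ->
        criticality_ok F p t k /\ acceptance_ok F p t k
    & forall k0, stop t = Some k0 ->
        restoration_iter p t k0 \/ cr_endless F p t k0].

Definition used_model (R : realType) (n K M P : nat) (F : functions R n K M P)
    (p : constants R) (t : run_data R n K M P) (k : nat)
    (m : functions R n K M P) (D : R) : Prop :=
  [\/ m = models0 t k /\ D = radius0 t k,
      [/\ ~ restoration_iter p t k, criticality_test F p t k
        & exists2 j, cr_built p t k j & m = cr_mod t k j /\ D = cr_rad t k j]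
    | completed t k /\ (m = models t k /\ D = radius t k)].

Definition A1 (R : realType) (n K M P : nat) (p : constants R)
    (t : run_data R n K M P) : Prop :=
  (forall k, started t k -> 0 < radius0 t k < Delta_max p) /\
  (forall k, completed t k -> 0 < radius t k <= radius0 t k).

Definition A2 (R : realType) (n K M P : nat) (F : functions R n K M P)
    (t : run_data R n K M P) : Prop :=
  (exists U, [/\ open U, Cset t `<=` U & each (C2_on U) F]) /\
  each (fun phi => exists2 L, 0 <= L & lipschitz_grad L (Cset t) phi) F.

Definition fully_linear (R : realType) (n K M P : nat)
    (t : run_data R n K M P) (k : nat) (D e edot L : R)
    (phi phih : 'rV[R]_n -> R) : Prop :=
  [/\ forall xi, Cset t xi -> differentiable phih xi,
      lipschitz_grad L (Cset t) phih
    & forall xi, tr_ball t k D xi -> Cset t xi ->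
        enorm (grad phi xi - grad phih xi) <= edot * D /\
        `|phi xi - phih xi| <= e * D ^+ 2].

Definition good_model (R : realType) (n K M P : nat) (F : functions R n K M P)
    (t : run_data R n K M P) (k : nat) (D e edot L : R)
    (m : functions R n K M P) : Prop :=
  each2 (fully_linear t k D e edot L) F m /\
  each2 (fun phi phih => phih (iter_x t k) = phi (iter_x t k)) F m.

Definition A3 (R : realType) (n K M P : nat) (F : functions R n K M P)
    (p : constants R) (t : run_data R n K M P) : Prop :=
  exists e edot L : R,
    [/\ [/\ 0 < e, 0 < edot & 0 < L],
        edot / 2 <= e,
        each (fun phi => exists Lphi,
          [/\ 0 <= Lphi, lipschitz_grad Lphi (Cset t) phi & L + Lphi <= e]) F,
        forall k, started t k -> forall m D, used_model F p t k m D ->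
          good_model F t k D e edot L m
      & forall k, started t k -> forall D, 0 < D <= Delta_max p ->
          exists m, good_model F t k D e edot L m].

Definition A4 (R : realType) (n K M P : nat) (F : functions R n K M P)
    (p : constants R) (t : run_data R n K M P) : Prop :=
  exists2 c_ubn, 0 < c_ubn &
    forall k, started t k -> theta F (iter_x t k) <= delta_n p ->
      forall m D, used_model F p t k m D ->
        exists2 s, normal_step m (iter_x t k) s
          & tr_norm t k s <= c_ubn * theta F (iter_x t k).

Definition A5 (R : realType) (n K M P : nat) (t : run_data R n K M P) : Prop :=
  exists2 c : R, 1 <= c &
    forall k, started t k -> forall x,
      (c^-1 * tr_norm t k x <= enorm x <= c * tr_norm t k x) /\
      (c^-1 * pb_norm t k x <= enorm x <= c * pb_norm t k x).

Definition A6 (R : realType) (n K M P : nat) (t : run_data R n K M P) : Prop :=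
  exists2 H : R, 0 < H &
    forall k, completed t k -> forall l xi,
      lin_set (models t k) (iter_x t k) xi -> tr_ball t k (radius t k) xi ->
      twice_differentiable (obj (models t k) l) xi /\
      opnorm2 (hess (obj (models t k) l) xi) <= H.

Definition A7 (R : realType) (n K M P : nat) (p : constants R)
    (t : run_data R n K M P) : Prop :=
  exists c_sd W : R, 0 < c_sd < 1 /\ 1 <= W /\
    forall k, completed t k -> ~ restoration_iter p t k ->
      let xn := iter_x t k + nstep t k in
      let y := xn + sigma t k *: tstep t k in
      let w2 := omega (models t k) (iter_x t k) xn (@enorm R n) in
      compatible_normal_step p t k (models t k) (nstep t k) (radius t k) ->
      tangential_minimizer (models t k) (iter_x t k) xn (pb_norm t k) (tstep t k) ->
      [/\ 0 <= sigma t k,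
          lin_set (models t k) (iter_x t k) y,
          tr_ball t k (radius t k) y
        & c_sd * w2 * Num.min (w2 / W) (Num.min (radius t k) 1)
            <= maxobj (models t k) xn - maxobj (models t k) y].

Definition A8 (R : realType) (n K M P : nat) (t : run_data R n K M P) : Prop :=
  exists S : set 'rV[R]_n, [/\ closed S, bounded_set S & Cset t `<=` S].

Definition quasi_stationary_seq (R : realType) (n K M P : nat)
    (F : functions R n K M P) (xs : nat -> 'rV[R]_n) (chis Ds : nat -> R)
    (xbar : 'rV[R]_n) : Prop :=
  [/\ xs i @[i --> \oo] --> xbar,
      theta F (xs i) @[i --> \oo] --> theta F xbar,
      theta F xbar = 0,
      chis i @[i --> \oo] --> 0
    & Ds i @[i --> \oo] --> 0].

(* Either a subsequence of an infinite outer sequence, restricted to iterations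
   that compute chi (those without restoration), or the inner sequence of an
   infinite Criticality Routine. *)
Definition quasi_stationary (R : realType) (n K M P : nat)
    (F : functions R n K M P) (p : constants R) (t : run_data R n K M P)
    (xbar : 'rV[R]_n) : Prop :=
  (stop t = None /\
   exists ks : nat -> nat,
     [/\ {homo ks : i j / (i < j)%N},
         forall i, ~ restoration_iter p t (ks i)
       & quasi_stationary_seq F (fun i => iter_x t (ks i))
           (fun i => chi t (ks i)) (fun i => radius t (ks i)) xbar]) \/
  (exists k, [/\ stop t = Some k, cr_endless F p t k
     & quasi_stationary_seq F (fun=> iter_x t k) (cr_chi t k) (cr_rad t k)
         xbar]).

(* Main.v *)
(* The argument is direct, without multipliers of the tangential subproblems. If
   xbar is not a KKT point, Motzkin's alternative and the MFCQ give a direction d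
   along which all objectives and all active inequality constraints strictly
   decrease at xbar, while the equality constraints are stationary. The gradients
   of the surrogates converge to those of the problem because they are fully
   linear on balls of vanishing radius. Hence d, projected onto the kernel of the
   surrogate Jacobian of the equality constraints and scaled by a fixed tau > 0,
   is eventually feasible for the tangential subproblem with a value below a
   fixed negative number, contradicting that the criticality measures vanish. *)

Require Import Defs.
From mathcomp Require Import all_boot all_order all_algebra.
From mathcomp Require Import all_classical all_reals all_analysis.
From mathcomp Require Import ring lra.
Import Order.TTheory GRing.Theory Num.Theory.
Import numFieldNormedType.Exports.
Local Open Scope classical_set_scope.
Local Open Scope ring_scope.

(** * Entrywise limits of matrices *)

Section EntrywiseLimits.
Context {R : realType} {T : Type} (G : set_system T) {GG : Filter G}.

(** Working entry by entry reduces limits of products, determinants and inverses to limits of real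
    sums and products. *)
Definition mx_cvg {m n : nat} (A_ : T -> 'M[R]_(m, n)) (A : 'M[R]_(m, n)) :=
  forall i j, A_ t i j @[t --> G] --> A i j.

Lemma cvg_sumr (I : Type) (r : seq I) (a_ : I -> T -> R) (a : I -> R) :
  (forall i, a_ i t @[t --> G] --> a i) ->
  \sum_(i <- r) a_ i t @[t --> G] --> \sum_(i <- r) a i.
Proof. by move=> h; apply: cvg_big => //; exact: add_continuous. Qed.

Lemma cvg_prodr (I : Type) (r : seq I) (a_ : I -> T -> R) (a : I -> R) :
  (forall i, a_ i t @[t --> G] --> a i) ->
  \prod_(i <- r) a_ i t @[t --> G] --> \prod_(i <- r) a i.
Proof. by move=> h; apply: cvg_big => //; exact: mul_continuous. Qed.

Lemma mx_cvg_cst m n (A : 'M[R]_(m, n)) : mx_cvg (fun=> A) A.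
Proof. by move=> i j; exact: cvg_cst. Qed.

Lemma mx_cvgB m n (A_ B_ : T -> 'M[R]_(m, n)) A B :
  mx_cvg A_ A -> mx_cvg B_ B -> mx_cvg (fun t => A_ t - B_ t) (A - B).
Proof.
move=> hA hB i j; rewrite !mxE.
under eq_cvg do rewrite !mxE.
exact: cvgB.
Qed.

Lemma mx_cvg_tr m n (A_ : T -> 'M[R]_(m, n)) A :
  mx_cvg A_ A -> mx_cvg (fun t => (A_ t)^T) A^T.
Proof.
move=> hA i j; rewrite !mxE.
under eq_cvg do rewrite !mxE.
exact: hA.
Qed.

Lemma mx_cvgM m n q (A_ : T -> 'M[R]_(m, n)) (B_ : T -> 'M[R]_(n, q)) A B :
  mx_cvg A_ A -> mx_cvg B_ B -> mx_cvg (fun t => A_ t *m B_ t) (A *m B).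
Proof.
move=> hA hB i j; rewrite !mxE.
under eq_cvg do rewrite !mxE.
by apply: cvg_sumr => k; exact: cvgM.
Qed.

Lemma cvg_det m (A_ : T -> 'M[R]_m) A :
  mx_cvg A_ A -> \det (A_ t) @[t --> G] --> \det A.
Proof.
move=> hA; apply: cvg_sumr => s; apply: cvgM; first exact: cvg_cst.
by apply: cvg_prodr => i; exact: hA.
Qed.

Lemma mx_cvgV m (A_ : T -> 'M[R]_m) A :
  A \in unitmx -> mx_cvg A_ A -> mx_cvg (fun t => invmx (A_ t)) (invmx A).
Proof.
rewrite unitmxE unitfE => uA hA i j.
have dA := cvg_det _ _ _ hA.
(* [invmx] returns a singular matrix unchanged, so the adjugate formula is used only where the
   determinant is nonzero, which holds eventually. *)
apply: (@cvg_trans _ ((\det (A_ t))^-1 * (\adj (A_ t)) i j @[t --> G])).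
  apply: near_eq_cvg.
  near=> t; have ut : \det (A_ t) != 0 by near: t; exact: cvgr_neq0 dA uA.
  by rewrite /invmx unitmxE unitfE ut !mxE.
rewrite /invmx unitmxE unitfE uA !mxE.
under eq_cvg do rewrite !mxE.
apply: cvgM; first exact: cvgV.
rewrite /cofactor; apply: cvgM; first exact: cvg_cst.
apply: cvg_det => a b; rewrite !mxE.
under eq_cvg do rewrite !mxE.
exact: hA.
Unshelve. all: by end_near. Qed.

End EntrywiseLimits.

(** * Dot product and Euclidean norm *)

Lemma dotp_mulmx (R : realType) n (u v : 'rV[R]_n) : dotp u v = (u *m v^T) 0 0.
Proof. by rewrite mxE; apply: eq_bigr => i _; rewrite mxE. Qed.

Lemma cvg_dotp (R : realType) (T : Type) (G : set_system T) {GG : Filter G} n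
    (u_ v_ : T -> 'rV[R]_n) u v :
  mx_cvg G u_ u -> mx_cvg G v_ v ->
  dotp (u_ t) (v_ t) @[t --> G] --> dotp u v.
Proof.
move=> hu hv; rewrite dotp_mulmx.
under eq_cvg do rewrite dotp_mulmx.
by apply: mx_cvgM => //; exact: mx_cvg_tr.
Qed.

Section InnerProduct.
Context {R : realType} {n : nat}.
Implicit Types u v w : 'rV[R]_n.

Lemma dotpC u v : dotp u v = dotp v u.
Proof. by apply: eq_bigr => i _; rewrite mulrC. Qed.

Lemma dotpDl u v w : dotp (u + v) w = dotp u w + dotp v w.
Proof. by rewrite !dotp_mulmx mulmxDl mxE. Qed.

Lemma dotpDr u v w : dotp w (u + v) = dotp w u + dotp w v.
Proof. by rewrite dotpC dotpDl !(dotpC w). Qed.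

Lemma dotpZl a u w : dotp (a *: u) w = a * dotp u w.
Proof. by rewrite !dotp_mulmx -scalemxAl mxE. Qed.

Lemma dotpZr a u w : dotp w (a *: u) = a * dotp w u.
Proof. by rewrite dotpC dotpZl dotpC. Qed.

Lemma dotp0l w : dotp 0 w = 0.
Proof. by rewrite dotp_mulmx mul0mx mxE. Qed.

Lemma dotp_suml (I : Type) (r : seq I) (F : I -> 'rV[R]_n) w :
  dotp (\sum_(i <- r) F i) w = \sum_(i <- r) dotp (F i) w.
Proof.
by rewrite dotp_mulmx mulmx_suml summxE; apply: eq_bigr => i _; rewrite dotp_mulmx.
Qed.

Lemma dotp_ge0 u : 0 <= dotp u u.
Proof. by apply: sumr_ge0 => i _; rewrite -expr2 sqr_ge0. Qed.

Lemma dotp_eq0 u : dotp u u = 0 -> u = 0.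
Proof.
move=> /psumr_eq0P h; apply/rowP => i; rewrite mxE.
by apply/eqP; rewrite -sqrf_eq0 expr2 h // => j _; rewrite -expr2 sqr_ge0.
Qed.

Lemma enorm_ge0 u : 0 <= enorm u.
Proof. exact: sqrtr_ge0. Qed.

Lemma coord_le_enorm u i : `|u 0 i| <= enorm u.
Proof.
rewrite -sqrtr_sqr ler_sqrt ?dotp_ge0 // expr2 /dotp (bigD1 i) //= lerDl.
by apply: sumr_ge0 => j _; rewrite -expr2 sqr_ge0.
Qed.

Lemma enormZ a u : enorm (a *: u) = `|a| * enorm u.
Proof.
by rewrite /enorm dotpZl dotpZr mulrA -expr2 sqrtrM ?sqr_ge0 // sqrtr_sqr.
Qed.

End InnerProduct.

(** * Gordan's alternative *)

(* The point of the simplex minimizing the norm of the convex combination: if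
   that minimal combination w is nonzero then -w is a common descent
   direction. *)
Lemma gordan (R : realType) (N n : nat) (Q : pred 'I_N) (V : 'M[R]_(N, n)) :
  (exists d, forall i, Q i -> dotp (row i V) d < 0) \/
  (exists u : 'rV[R]_N, [/\ forall i, 0 <= u 0 i, forall i, ~~ Q i -> u 0 i = 0,
     \sum_i u 0 i = 1 & u *m V = 0]).
Proof.
pose S : set 'rV[R]_N := [set u | [/\ forall i, 0 <= u 0 i,
  forall i, ~~ Q i -> u 0 i = 0 & \sum_i u 0 i = 1]].
(* If no index satisfies [Q], then [S] is empty and the first alternative holds vacuously. *)
have [[i0 Qi0]|nQ] := pselect (exists i, Q i); last first.
  by left; exists 0 => i Qi; case: nQ; exists i.
have vertex i : Q i -> S (delta_mx 0 i).
  move=> Qi; split=> [j|j nQj|].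
  - by rewrite mxE eqxx /=; case: (j == i).
  - by rewrite mxE eqxx /=; case: eqP nQj => // ->; rewrite Qi.
  - rewrite (bigD1 i) //= mxE !eqxx big1 ?addr0 // => j /negPf ji.
    by rewrite mxE ji andbF.
have cS : compact S.
  apply: bounded_closed_compact.
    exists 1; split => // M M1 u [u0 _ u1].
    rewrite /Num.norm /= mx_normrE.
    apply/bigmax_leP; split => [|[a i] _ /=]; first by lra.
    rewrite (ord1 a) ger0_norm //; apply: le_trans (ltW M1).
    by rewrite -u1 (bigD1 i) //= lerDl sumr_ge0.
  have -> : S = \bigcap_(i in setT) [set u : 'rV[R]_N | 0 <= u 0 i] `&`
      \bigcap_(i in [set i | ~~ Q i]) [set u : 'rV[R]_N | u 0 i = 0] `&`
      [set u : 'rV[R]_N | \sum_i u 0 i = 1].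
    apply/seteqP; split => u /=.
      by case=> h1 h2 h3; split => //; split => i; [move=> _; exact: h1 | exact: h2].
    by case=> [[h1 h2] h3]; split => // i; exact: h1.
  apply: closedI; first apply: closedI.
  - apply: closed_bigI => i _.
    by have /continuous_closedP/(_ _ (@closed_ge R 0)) :=
      @coord_continuous R 1 N 0 i.
  - apply: closed_bigI => i _.
    by have /continuous_closedP/(_ _ (@closed_eq R 0)) :=
      @coord_continuous R 1 N 0 i.
  - have /continuous_closedP : continuous (fun u : 'rV[R]_N => \sum_i u 0 i).
      by move=> u; apply: (@cvg_sumr _ _ (nbhs u)) => i; exact: coord_continuous.
    by move=> /(_ _ (@closed_eq R 1)).
pose f (u : 'rV[R]_N) := dotp (u *m V) (u *m V).
have cf : {within S, continuous f}.
  apply: continuous_subspaceT => u; apply: (@cvg_dotp _ _ (nbhs u));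
    by apply: mx_cvgM (mx_cvg_cst _ _ _ _) => i j; exact: coord_continuous.
have S0 : S !=set0 by exists (delta_mx 0 i0); exact: vertex.
have [u uS umin] := EVT_min_rV S0 cS cf.
rewrite inE in uS; case: (uS) => u0 uQ u1.
have [w0|/eqP wn0] := eqVneq (u *m V) 0; first by right; exists u.
left; set w := u *m V in wn0; exists (- w) => i Qi.
have ww : 0 < dotp w w.
  by rewrite lt_neqAle dotp_ge0 andbT eq_sym; apply/eqP => /dotp_eq0.
have wE : row i V = delta_mx 0 i *m V by rewrite rowE.
(* This is the variational inequality of the minimal-norm point. *)
suff : dotp w w <= dotp (row i V) w.
  by rewrite -scaleN1r dotpZr; lra.
rewrite leNgt; apply/negP => lt.
set b := dotp (row i V) w in lt; set a := dotp w w in ww lt.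
set e := dotp (row i V) (row i V).
have e0 : 0 <= e by exact: dotp_ge0.
(* Minimality of [u] is tested on the segment from [u] to vertex [i]. *)
have q t : 0 <= t <= 1 -> a <= (1 - t) ^+ 2 * a + 2 * t * (1 - t) * b + t ^+ 2 * e.
  move=> /andP[t0 t1].
  have St : S ((1 - t) *: u + t *: delta_mx 0 i).
    have [d0 dQ d1] := vertex i Qi; split.
    - move=> j; rewrite !mxE; have := u0 j; have := d0 j; rewrite !mxE.
      by move=> *; rewrite addr_ge0 // mulr_ge0 //; lra.
    - by move=> j nQj; have := dQ j nQj; rewrite !mxE uQ // => ->; rewrite !mulr0 addr0.
    - under eq_bigr do rewrite !mxE.
      rewrite big_split /= -!mulr_sumr u1; move: d1.
      by under eq_bigr do rewrite !mxE; move=> ->; lra.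
  have := umin _ (mem_set St); rewrite /f mulmxDl -!scalemxAl -/w -wE.
  rewrite !(dotpDl, dotpDr) !(dotpZl, dotpZr) (dotpC w (row i V)) -/a -/b -/e.
  lra.
(* Moving by [t] changes the squared norm by [t * (t * c - 2 * (a - b))], with [c] the squared norm
   of [w - row i V]. This choice gives [t * c <= a - b], hence a decrease; the summands [a - b] keep
   the denominator positive and [t <= 1]. *)
pose t := (a - b) / (a - b + (a - 2 * b + e) + (a - b)).
have c0 : 0 <= a - 2 * b + e.
  have := dotp_ge0 (w - row i V).
  rewrite -scaleN1r !(dotpDl, dotpDr) !(dotpZl, dotpZr) (dotpC w (row i V)) -/a -/b -/e.
  lra.
set c := a - 2 * b + e in c0 t.
have s0 : 0 < a - b + c + (a - b) by lra.
have t0 : 0 < t by rewrite divr_gt0 //; lra.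
have ts : t * (a - b + c + (a - b)) = a - b by rewrite /t mulrVK // unitfE; lra.
have t1 : t <= 1 by rewrite ler_pdivrMr //; lra.
have /q : 0 <= t <= 1 by rewrite (ltW t0) t1.
have -> : (1 - t) ^+ 2 * a + 2 * t * (1 - t) * b + t ^+ 2 * e =
   a + t * (t * c - 2 * (a - b)) by rewrite /c; ring.
have : t * (t * c - 2 * (a - b)) < 0.
  by rewrite pmulr_rlt0 //; nra.
lra.
Qed.

(** * Projection onto a kernel and Motzkin's alternative *)

(** If the Gram matrix [B *m B^T] is invertible, this is the orthogonal projection of row vectors
    onto the orthogonal complement of the rows of [B]. The closed formula makes its continuity in
    [B] accessible. *)
Definition null_proj {R : realType} {M n : nat} (B : 'M[R]_(M, n)) : 'M[R]_n :=
  1%:M - B^T *m invmx (B *m B^T) *m B.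

Lemma gram_unitmx (R : realType) (M n : nat) (B : 'M[R]_(M, n)) :
  row_free B -> B *m B^T \in unitmx.
Proof.
move=> fB; rewrite -row_free_unit; apply: inj_row_free => v vBB.
have /dotp_eq0/eqP : dotp (v *m B) (v *m B) = 0.
  by rewrite dotp_mulmx trmx_mul mulmxA -(mulmxA v) vBB mul0mx mxE.
by rewrite mulmx_free_eq0 // => /eqP.
Qed.

Lemma null_proj_trmx (R : realType) (M n : nat) (B : 'M[R]_(M, n)) :
  (null_proj B)^T = null_proj B.
Proof.
rewrite /null_proj linearB /= trmx1 !trmx_mul trmx_inv trmx_mul trmxK.
by rewrite mulmxA.
Qed.

Lemma null_proj_mulmx_tr (R : realType) (M n : nat) (B : 'M[R]_(M, n)) :
  B *m B^T \in unitmx -> null_proj B *m B^T = 0.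
Proof.
by move=> uB; rewrite /null_proj mulmxBl mul1mx -!mulmxA mulVmx // mulmx1 subrr.
Qed.

Lemma mulmx_null_proj (R : realType) (M n m : nat) (B : 'M[R]_(M, n))
    (d : 'M[R]_(m, n)) :
  d *m B^T = 0 -> d *m null_proj B = d.
Proof.
by move=> dB; rewrite /null_proj mulmxBr mulmx1 !mulmxA dB !mul0mx subr0.
Qed.

(** Gordan's alternative is applied to the rows of [V] projected onto the kernel of [B]; since the
    projection is symmetric, it can be moved from the rows to the direction. *)
Lemma motzkin (R : realType) (N n M : nat) (Q : pred 'I_N) (V : 'M[R]_(N, n))
    (B : 'M[R]_(M, n)) : row_free B ->
  (exists2 d, d *m B^T = 0 & forall i, Q i -> dotp (row i V) d < 0) \/
  (exists (u : 'rV[R]_N) (w : 'rV[R]_M), [/\ forall i, 0 <= u 0 i,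
     forall i, ~~ Q i -> u 0 i = 0, \sum_i u 0 i = 1 & u *m V + w *m B = 0]).
Proof.
move=> /gram_unitmx uB.
have [[d dV]|[u [u0 uQ u1 uV]]] := gordan R N n Q (V *m null_proj B).
  left; exists (d *m null_proj B).
    by rewrite -mulmxA null_proj_mulmx_tr // mulmx0.
  move=> i /dV; rewrite !dotp_mulmx trmx_mul null_proj_trmx row_mul.
  by rewrite mulmxA.
(* A vanishing projection makes [u *m V] a combination of the rows of [B]; the witness is minus its
   coefficients. *)
right; exists u, (- (u *m V *m B^T *m invmx (B *m B^T))); split => //.
by move: uV; rewrite /null_proj mulmxBr mulmx1 mulmxBr !mulmxA mulNmx.
Qed.

(** * Multipliers and descent directions *)

Lemma theta0_feasible (R : realType) (n K M P : nat) (F : functions R n K M P)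
    (x : 'rV[R]_n) : theta F x = 0 -> feasible F x.
Proof.
move=> t0; split=> l.
  apply/eqP; rewrite -normr_le0 -t0 /theta le_max; apply/orP; left.
  exact: (le_bigmax 0 (fun l => `|eqc F l x|)).
rewrite -t0 /theta le_max; apply/orP; right.
exact: (le_bigmax 0 (fun l => ineq F l x)).
Qed.

Lemma dotp_row_tr (R : realType) (M n : nat) (b : 'I_M -> 'rV[R]_n) (d : 'rV[R]_n) :
  (d *m (\matrix_l b l)^T = 0) <-> (forall l, dotp (b l) d = 0).
Proof.
have E l : (d *m (\matrix_l b l)^T) 0 l = dotp (b l) d.
  by rewrite mxE; apply: eq_bigr => i _; rewrite !mxE mulrC.
split=> [h l|h]; first by rewrite -E h mxE.
by apply/rowP => l; rewrite E h mxE.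
Qed.

(* If only constraint multipliers occurred in Motzkin's alternative, pairing
   with the MFCQ direction would force them to vanish; so the objective
   multipliers can be normalized. *)
Lemma KKT_or_descent (R : realType) (n K M P : nat) (F : functions R n K M P)
    (x : 'rV[R]_n) : feasible F x -> MFCQ F x ->
  KKT_point F x \/
  exists d, [/\ forall l, dotp (grad (obj F l) x) d < 0,
    forall l, dotp (grad (eqc F l) x) d = 0 &
    forall l, ineq F l x = 0 -> dotp (grad (ineq F l) x) d < 0].
Proof.
move=> fx [fB [d0 [d0h d0g]]].
set B := \matrix_(l < M) grad (eqc F l) x in fB.
pose V : 'M[R]_(K.+1 + P, n) :=
  col_mx (\matrix_l grad (obj F l) x) (\matrix_l grad (ineq F l) x).
(* [Q] selects all objectives and the active inequalities; multipliers vanish outside [Q], which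
   gives complementarity. *)
pose Q (i : 'I_(K.+1 + P)) :=
  if fintype.split i is inr l then ineq F l x == 0 else true.
have Ql l : Q (lshift P l) by rewrite /Q (unsplitK (inl l)).
have Qr l : Q (rshift K.+1 l) = (ineq F l x == 0) by rewrite /Q (unsplitK (inr l)).
have Vl l : row (lshift P l) V = grad (obj F l) x by rewrite rowKu rowK.
have Vr l : row (rshift K.+1 l) V = grad (ineq F l) x by rewrite rowKd rowK.
have [[d dB dV]|[u [w [u0 uQ u1 uVB]]]] := motzkin R _ _ _ Q V B fB.
  right; exists d; split => [l||l gl0].
  - by rewrite -Vl; exact: dV.
  - exact/dotp_row_tr.
  - by rewrite -Vr; apply: dV; rewrite Qr gl0.
left; split => //.
pose lam l := u 0 (lshift P l); pose nu l := u 0 (rshift K.+1 l).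
have combE : \sum_l lam l *: grad (obj F l) x + \sum_l w 0 l *: grad (eqc F l) x
    + \sum_l nu l *: grad (ineq F l) x = 0.
  apply: etrans uVB; rewrite addrAC; congr (_ + _).
    rewrite mulmx_sum_row [RHS]big_split_ord /=.
    by congr (_ + _); apply: eq_bigr => l _; rewrite ?Vl ?Vr.
  by rewrite mulmx_sum_row; apply: eq_bigr => l _; rewrite rowK.
have nug l : nu l * ineq F l x = 0.
  have [->|gl] := eqVneq (ineq F l x) 0; first by rewrite mulr0.
  by rewrite /nu uQ ?mul0r // Qr.
set s := \sum_l lam l.
have s0 : 0 <= s by apply: sumr_ge0 => l _; exact: u0.
have s_neq0 : s != 0.
  apply/eqP => slam0.
  have lam0 l : lam l = 0 by apply: (psumr_eq0P _ slam0) => // j _; exact: u0.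
  have nu1 : \sum_l nu l = 1.
    by rewrite -u1 big_split_ord /= [X in _ = X + _]big1 ?add0r // => l _; exact: lam0.
  have : dotp (\sum_l nu l *: grad (ineq F l) x) d0 = 0.
    move: (congr1 (fun v => dotp v d0) combE); rewrite dotpDl dotp0l.
    have -> : dotp (\sum_l lam l *: grad (obj F l) x
        + \sum_l w 0 l *: grad (eqc F l) x) d0 = 0.
      rewrite dotpDl !dotp_suml !big1 ?addr0 // => l _; rewrite dotpZl.
        by rewrite d0h mulr0.
      by rewrite lam0 ?mul0r.
    by rewrite add0r.
  (* All terms of this zero sum are nonpositive, so each vanishes. For an active constraint the
     slope along [d0] is negative, which forces [nu l = 0]. *)
  rewrite dotp_suml => /eqP; rewrite -oppr_eq0 -sumrN => /eqP/psumr_eq0P nud.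
  have nu0 l : nu l = 0.
    have [gl|gl] := eqVneq (ineq F l x) 0; last by rewrite /nu uQ // Qr.
    apply/eqP; rewrite -(mulIr_eq0 _ (mulIf (ltr0_neq0 (d0g l gl)))).
    rewrite -dotpZl -oppr_eq0; apply/eqP; apply: nud => // j _.
    rewrite dotpZl oppr_ge0; have [gj|gj] := eqVneq (ineq F j x) 0.
      by rewrite mulr_ge0_le0 ?u0 // ltW // d0g.
    by rewrite /nu uQ ?mul0r // Qr.
  by move: nu1; rewrite big1 // => /eqP; rewrite eq_sym oner_eq0.
exists (fun l => s^-1 * lam l), (fun l => s^-1 * w 0 l), (fun l => s^-1 * nu l).
split => [l||l||l].
- by rewrite mulr_ge0 ?invr_ge0 ?u0.
- by rewrite -mulr_sumr mulVf.
- by rewrite mulr_ge0 ?invr_ge0 ?u0.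
- under eq_bigr do rewrite -scalerA.
  under [X in _ + X + _]eq_bigr do rewrite -scalerA.
  under [X in _ + X]eq_bigr do rewrite -scalerA.
  by rewrite -!scaler_sumr -!scalerDr combE scaler0.
- by rewrite -mulrA nug mulr0.
Qed.

(** * Vanishing criticality measures in the limit *)

Lemma exists_pos_lt (R : realType) (I : finType) (e : I -> R) :
  (forall i, 0 < e i) -> exists2 r, 0 < r & forall i, r < e i.
Proof.
move=> e0; set b := \big[Num.min/1]_i e i.
have b0 : 0 < b by apply/bigmin_gtP; split.
exists (b / 2) => [|i]; first by rewrite divr_gt0.
by apply: (@lt_le_trans _ _ b); [lra | exact: bigmin_le].
Qed.

Lemma mx_cvg_null_proj (R : realType) (T : Type) (G : set_system T) {GG : Filter G}
    (M n : nat) (B_ : T -> 'M[R]_(M, n)) B :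
  row_free B -> mx_cvg G B_ B ->
  mx_cvg G (fun t => null_proj (B_ t)) (null_proj B).
Proof.
move=> /gram_unitmx uB hB; apply: mx_cvgB; first exact: mx_cvg_cst.
apply: mx_cvgM => //; apply: mx_cvgM; first exact: mx_cvg_tr.
by apply: mx_cvgV => //; apply: mx_cvgM => //; exact: mx_cvg_tr.
Qed.

Lemma lin_setE (R : realType) (n K M P : nat) (m : functions R n K M P)
    (x s : 'rV[R]_n) :
  lin_set m x (x + s) <->
  (forall l, eqc m l x + dotp (grad (eqc m l) x) s = 0) /\
  (forall l, ineq m l x + dotp (grad (ineq m l) x) s <= 0).
Proof. by split=> [[s' hs' /addrI <-] //|hs]; exists s. Qed.

(** The limit argument, detached from the run. Objective gradients are taken at [xs i + ss i] and
    constraint gradients at [xs i], as in the tangential problem. In [hchi] every feasible pair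
    bounds the measure from below, so exhibiting one pair suffices. *)
Lemma KKT_of_vanishing_criticality (R : realType) (n K M P : nat)
    (F : functions R n K M P) (xbar : 'rV[R]_n) (xs ss : nat -> 'rV[R]_n)
    (m : nat -> functions R n K M P) (N : nat -> 'rV[R]_n -> R) (c : R)
    (chis : nat -> R) :
  feasible F xbar -> MFCQ F xbar ->
  0 < c -> (forall i d, N i d <= c * enorm d) ->
  (forall l, mx_cvg \oo (fun i => grad (obj (m i) l) (xs i + ss i))
     (grad (obj F l) xbar)) ->
  (forall l, mx_cvg \oo (fun i => grad (eqc (m i) l) (xs i))
     (grad (eqc F l) xbar)) ->
  (forall l, mx_cvg \oo (fun i => grad (ineq (m i) l) (xs i))
     (grad (ineq F l) xbar)) ->
  (forall l, ineq (m i) l (xs i) @[i --> \oo] --> ineq F l xbar) ->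
  mx_cvg \oo ss 0 ->
  (forall i, lin_set (m i) (xs i) (xs i + ss i)) ->
  (forall i beta d,
     tangential_feasible (m i) (xs i) (xs i + ss i) (N i) beta d ->
     Num.min 1 (- beta) <= chis i) ->
  chis i @[i --> \oo] --> 0 ->
  KKT_point F xbar.
Proof.
move=> fx mf c0 hN hobj heq hineq hval hss hlin hchi chi0.
have [//|[d [dobj deq dineq]]] := KKT_or_descent _ _ _ _ _ _ _ fx mf; exfalso.
have [fB _] := mf; set B := \matrix_l _ in fB.
pose B_ i : 'M[R]_(M, n) := \matrix_l grad (eqc (m i) l) (xs i).
pose D_ i := d *m null_proj (B_ i).
have cvB : mx_cvg \oo B_ B.
  by move=> l j; rewrite !mxE; under eq_cvg do rewrite !mxE; have := heq l 0 j;
    rewrite !mxE; under eq_cvg do rewrite !mxE.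
have cvD : mx_cvg \oo D_ d.
  have <- : d *m null_proj B = d by apply: mulmx_null_proj; exact/dotp_row_tr.
  by apply: mx_cvgM; [exact: mx_cvg_cst | exact: mx_cvg_null_proj].
have [eps eps0 heps] : exists2 r, 0 < r &
    forall l, r < - dotp (grad (obj F l) xbar) d.
  by apply: exists_pos_lt => l; rewrite oppr_gt0.
(* A step below [delta l] keeps the linearization of an inactive constraint negative; the [+ 1]
   avoids division by zero. For an active constraint the value 1 is arbitrary. *)
pose delta l := if ineq F l xbar == 0 then 1 else
  - ineq F l xbar / (`|dotp (grad (ineq F l) xbar) d| + 1).
have [tau0 tau00 htau0] : exists2 r, 0 < r & forall l, r < delta l.
  apply: exists_pos_lt => l; rewrite /delta; case: ifPn => gl; first exact: ltr01.
  apply: divr_gt0; last by rewrite ltr_wpDl.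
  by rewrite oppr_gt0 lt_neqAle gl fx.2.
(* The second bound makes the scaled direction admissible for [N i], because eventually
   [enorm (D_ i) <= 2 + dotp d d]. *)
pose tau := Num.min tau0 (c * (2 + dotp d d))^-1.
have dd0 := dotp_ge0 d.
have tau_gt0 : 0 < tau.
  by rewrite lt_min tau00 invr_gt0 mulr_gt0 //; lra.
have tauc : tau * (c * (2 + dotp d d)) <= 1.
  rewrite -ler_pdivlMr ?mul1r; last by rewrite mulr_gt0 //; lra.
  by rewrite /tau ge_min lexx orbT.
have taud l : tau < delta l by rewrite /tau gt_min htau0.
(* The tangential value [- (tau * eps)] forces the measure to be at least [r]. *)
pose r := Num.min 1 (tau * eps).
have r0 : 0 < r by rewrite lt_min ltr01 mulr_gt0.
have nearD : \forall i \near \oo, forall l, ineq (m i) l (xs i) +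
    dotp (grad (ineq (m i) l) (xs i)) (ss i + tau *: D_ i) <= 0.
  apply: filter_forall => l.
  have cvc : dotp (grad (ineq (m i) l) (xs i)) (D_ i) @[i --> \oo] -->
      dotp (grad (ineq F l) xbar) d by exact: cvg_dotp.
  have [gl|gl] := eqVneq (ineq F l xbar) 0.
    (* Active case: [ss i] already satisfies the linearized inequality, and the slope along [D_ i]
       is eventually negative. *)
    near=> i; have /lin_setE[_ /(_ l)] := hlin i.
    have : dotp (grad (ineq (m i) l) (xs i)) (D_ i) < 0.
      by near: i; apply: (cvgr_lt (dotp (grad (ineq F l) xbar) d)) => //; exact: dineq.
    rewrite dotpDr addrA dotpZr; nra.
  (* Inactive case: the linearized values tend to a number that is negative because
     [tau < delta l]. *)
  apply: (cvgr_le (ineq F l xbar + (0 + tau * dotp (grad (ineq F l) xbar) d))).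
    apply: cvgD => //; under eq_cvg do rewrite dotpDr dotpZr.
    apply: cvgD; last by apply: cvgM => //; exact: cvg_cst.
    by rewrite -(dotp0l (grad (ineq F l) xbar)) dotpC; exact: cvg_dotp.
  rewrite add0r; have := taud l; rewrite /delta (negPf gl).
  rewrite ltr_pdivlMr ?ltr_wpDl //.
  have := ler_norm (dotp (grad (ineq F l) xbar) d); nra.
suff : \forall i \near \oo, False by case/filter_ex.
near=> i.
have uB : B_ i *m (B_ i)^T \in unitmx.
  rewrite unitmxE unitfE; near: i.
  have := gram_unitmx _ _ _ _ fB; rewrite unitmxE unitfE.
  by apply: cvgr_neq0; apply: cvg_det; apply: mx_cvgM => //; exact: mx_cvg_tr.
have chii : chis i < r by near: i; exact: (cvgr_lt 0).
have DD : dotp (D_ i) (D_ i) < dotp d d + 1.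
  by near: i; apply: (cvgr_lt (dotp d d)); [exact: cvg_dotp | lra].
have ob l : dotp (grad (obj (m i) l) (xs i + ss i)) (D_ i) < - eps.
  move: l; near: i; apply: filter_forall => l.
  apply: (cvgr_lt (dotp (grad (obj F l) xbar) d)); first exact: cvg_dotp.
  by have := heps l; lra.
(* The projection makes this exact, not just asymptotic, so the linearized equalities stay
   satisfied. *)
have eqD l : dotp (grad (eqc (m i) l) (xs i)) (D_ i) = 0.
  by move: l; apply/dotp_row_tr; rewrite /D_ -mulmxA null_proj_mulmx_tr // mulmx0.
have /lin_setE[lineq linineq] := hlin i.
have ineqD l : ineq (m i) l (xs i) +
    dotp (grad (ineq (m i) l) (xs i)) (ss i + tau *: D_ i) <= 0.
  by move: l; near: i.
have tf : tangential_feasible (m i) (xs i) (xs i + ss i) (N i)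
    (- (tau * eps)) (tau *: D_ i).
  split.
  - by move=> l; rewrite dotpZr -mulrN ler_pM2l //; exact: ltW (ob l).
  - rewrite -addrA; apply/lin_setE; split => l; last exact: ineqD.
    by rewrite dotpDr dotpZr eqD mulr0 addr0.
  - apply: le_trans (hN _ _) _; rewrite enormZ gtr0_norm //.
    have : enorm (D_ i) <= 2 + dotp d d.
      rewrite /enorm; apply: (@le_trans _ _ (1 + dotp (D_ i) (D_ i))); last lra.
      have := dotp_ge0 (D_ i); set q := dotp _ _ => q0.
      have := sqrtr_ge0 q; have := sqr_sqrtr q0; nra.
    move=> le1; apply: (le_trans _ tauc); rewrite mulrCA ler_pM2l //.
    by rewrite ler_pM2l.
by have := hchi _ _ _ tf; rewrite opprK leNgt chii.
Unshelve. all: by end_near.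
Qed.

(** * Criticality measures occurring in a run *)

(* A criticality measure computed by the run, together with the surrogate, the
   normal step and the Defs.radius that it was computed for. After a break of the
   Criticality Routine this surrogate may differ from the final one. *)
Definition critical_step {R : realType} {n K M P : nat} (F : functions R n K M P)
    (p : constants R) (t : run_data R n K M P) (k : nat)
    (m : functions R n K M P) (s : 'rV[R]_n) (D chi : R) : Prop :=
  [/\ used_model F p t k m D, compatible_normal_step p t k m s D,
      0 < D <= Defs.radius0 t k,
      exists d, tangential_minimizer m (iter_x t k) (iter_x t k + s) (pb_norm t k) d
    & chi = crit_measure m (iter_x t k) (iter_x t k + s) (pb_norm t k)].

Section CriticalSteps.
Context {R : realType} {n K M P : nat} (F : functions R n K M P).
Context (p : constants R) (t : run_data R n K M P).
Hypotheses (hp : constants_ok p) (hrun : algorithm_run F p t) (hA1 : A1 p t).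

Lemma alpha_bounds : 0 < alpha p < 1.
Proof. by move: hp; rewrite /constants_ok; tauto. Qed.

Lemma c_Delta_bounds : 0 < c_Delta p < 1.
Proof. by move: hp; rewrite /constants_ok; tauto. Qed.

Lemma critical_step_start k : started t k -> ~ restoration_iter p t k ->
  critical_step F p t k (models0 t k) (nstep0 t k) (Defs.radius0 t k) (chi0 t k).
Proof.
move=> st nres; have [_ hst _ _ _] := hrun.
have [_ _ /(_ nres)[cn tm ce _]] := hst k st.
have [/(_ k st)/andP[r0 _] _] := hA1.
split => //; first by constructor.
  by rewrite r0 lexx.
by exists (tstep0 t k).
Qed.

(** By induction on [j]: each pass multiplies the radius by [alpha p], so it stays positive and at
    most the initial radius. *)
Lemma critical_step_cr k j : started t k -> ~ restoration_iter p t k ->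
  criticality_test F p t k -> (forall i, (i < j)%N -> cr_pass p t k i) ->
  critical_step F p t k (cr_mod t k j) (cr_nstep t k j) (cr_rad t k j)
    (cr_chi t k j).
Proof.
move=> st nres ct; have [_ hst _ _ _] := hrun.
have [_ _ /(_ nres)[_ _ _ /(_ ct)[ir [im [isn [_ ich]]]]]] := hst k st.
have [a0 a1] := andP alpha_bounds.
elim: j => [|j IH] hpass.
  by rewrite ir im isn ich; exact: critical_step_start.
have [|_ _ /andP[r0 r1] _ _] := IH.
  by move=> i ij; apply: hpass; exact: ltnW.
have [gj rE cn tm ce] := hpass j (ltnSn j).
split => //; last by exists (cr_tstep t k j.+1).
- constructor 2; split => //; exists j.+1 => //; split => // i ij.
  by apply: hpass; exact: ltnW.
- by rewrite rE mulr_gt0 //=; nra.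
Qed.

(** After the routine the surrogate of index [j] is taken, to which the final measure belongs even
    after a break. Its radius is at most the final one, so it vanishes whenever the final radii
    do. *)
Lemma critical_step_completed k : completed t k -> ~ restoration_iter p t k ->
  exists m s D, critical_step F p t k m s D (chi t k) /\ D <= Defs.radius t k.
Proof.
move=> ck nres; have [_ _ _ /(_ k ck nres)[[hct hnct] _] _] := hrun.
have st : started t k.
  by move: ck; rewrite /completed /started; case: (stop t) => // k0; exact: ltnW.
have [ct|nct] := pselect (criticality_test F p t k); last first.
  have [-> _ _ _ ->] := hnct nct.
  by exists (models0 t k), (nstep0 t k), (Defs.radius0 t k); split => //;
    exact: critical_step_start.
have [j [hpass _ _ chiE radE]] := hct ct.
exists (cr_mod t k j), (cr_nstep t k j), (cr_rad t k j).
have cs := critical_step_cr k j st nres ct hpass.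
split; first by rewrite chiE.
by have [_ _ /andP[_ le0] _ _] := cs; rewrite radE le_min le0 le_max lexx.
Qed.

End CriticalSteps.

(** * From critical steps to the limit argument *)

(** The minimizer bounds the admissible values from below, so [inf] is a genuine infimum and not a
    default value. *)
Lemma crit_measure_ge (R : realType) (n K M P : nat) (m : functions R n K M P)
    (x xn : 'rV[R]_n) (N : 'rV[R]_n -> R) (d0 : 'rV[R]_n) beta d :
  tangential_minimizer m x xn N d0 -> tangential_feasible m x xn N beta d ->
  Num.min 1 (- beta) <= crit_measure m x xn N.
Proof.
move=> [b0 _ b0min] tf; rewrite /crit_measure /omega.
have : inf [set beta | exists d, tangential_feasible m x xn N beta d] <= beta.
  by apply: ge_inf; [exists b0 => b [d' /b0min] | exists d].
by move=> le; rewrite le_min !ge_min lexx lerN2 le orbT.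
Qed.

Lemma norm_le_enorm (R : realType) (n : nat) (u : 'rV[R]_n) : `|u| <= enorm u.
Proof.
rewrite /Num.norm /= mx_normrE; apply/bigmax_leP; split => [|[a i] _ /=].
  exact: enorm_ge0.
by rewrite (ord1 a) coord_le_enorm.
Qed.

Lemma cvg_of_enorm_le (R : realType) (n : nat) (us : nat -> 'rV[R]_n)
    (Ds : nat -> R) (c : R) :
  (forall i, enorm (us i) <= c * Ds i) -> Ds i @[i --> \oo] --> 0 ->
  us i @[i --> \oo] --> (0 : 'rV[R]_n).
Proof.
move=> hu hD; apply/norm_cvg0P.
apply: (@squeeze_cvgr _ _ _ _ (fun=> 0) (fun i => c * Ds i)).
- near=> i; rewrite normr_ge0 /=; apply: le_trans (hu i).
  exact: norm_le_enorm.
- exact: cvg_cst.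
- by rewrite -(mulr0 c); apply: cvgM => //; exact: cvg_cst.
Unshelve. all: by end_near. Qed.

Lemma mx_cvg_of_cvg (R : realType) (T : Type) (G : set_system T) {GG : Filter G}
    (m n : nat) (A_ : T -> 'M[R]_(m, n)) A :
  A_ t @[t --> G] --> A -> mx_cvg G A_ A.
Proof.
move=> hA i j.
apply: (@cvg_comp _ _ _ A_ (fun B : 'M[R]_(m, n) => B i j) _ _ _ hA).
exact: coord_continuous.
Qed.

(** The surrogate gradient is the true gradient minus an error bounded by [edot * Ds i], which tends
    to 0. *)
Lemma mx_cvg_model_grad (R : realType) (n K M P : nat) (t : run_data R n K M P)
    (e edot L : R) (xbar : 'rV[R]_n) (ys : nat -> 'rV[R]_n) (ks : nat -> nat)
    (Ds : nat -> R) (phi : 'rV[R]_n -> R) (phih : nat -> 'rV[R]_n -> R) :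
  {for xbar, continuous (grad phi)} ->
  (forall i, fully_linear t (ks i) (Ds i) e edot L phi (phih i)) ->
  (forall i, tr_ball t (ks i) (Ds i) (ys i)) -> (forall i, Cset t (ys i)) ->
  ys i @[i --> \oo] --> xbar -> Ds i @[i --> \oo] --> 0 ->
  mx_cvg \oo (fun i => grad (phih i) (ys i)) (grad phi xbar).
Proof.
move=> cphi fl hball hC cys cD; apply: mx_cvg_of_cvg.
have -> : (fun i => grad (phih i) (ys i)) =
    (fun i => grad phi (ys i) - (grad phi (ys i) - grad (phih i) (ys i))).
  by apply/funext => i; rewrite opprB addrC subrK.
rewrite -[X in _ --> X]subr0; apply: cvgB.
  exact: (@cvg_comp _ _ _ ys (grad phi) _ _ _ cys cphi).
apply: (@cvg_of_enorm_le _ _ _ Ds edot) => // i.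
by have [_ _ /(_ _ (hball i) (hC i))[]] := fl i.
Qed.

(** Keeps the point reached by the normal step inside the ball where the surrogates are accurate. *)
Lemma compatible_le (R : realType) (n K M P : nat) (p : constants R)
    (t : run_data R n K M P) k s D :
  constants_ok p -> 0 < D -> compatible p t k s D -> tr_norm t k s <= D.
Proof.
move=> hp D0; have [c0 c1] := andP (c_Delta_bounds p hp).
move/le_trans; apply; have : Num.min 1 (c_mu p * D `^ mu_exp p) <= 1.
  by rewrite ge_min lexx.
set q := Num.min _ _ => q1.
by apply: (@le_trans _ _ (c_Delta p * D)); [rewrite ler_piMr // mulr_ge0 // ltW
  | rewrite ler_piMl // ltW].
Qed.

Lemma KKT_of_critical_steps (R : realType) (n K M P : nat)
    (F : functions R n K M P) (p : constants R) (t : run_data R n K M P)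
    (hF : each (C2_on setT) F) (hp : constants_ok p) (hrun : algorithm_run F p t)
    (hA1 : A1 p t) (hA3 : A3 F p t) (hA5 : A5 t) (xbar : 'rV[R]_n)
    (ks : nat -> nat) (m : nat -> functions R n K M P) (ss : nat -> 'rV[R]_n)
    (Ds chis : nat -> R) :
  MFCQ F xbar ->
  (forall i, started t (ks i)) ->
  (forall i, critical_step F p t (ks i) (m i) (ss i) (Ds i) (chis i)) ->
  quasi_stationary_seq F (fun i => iter_x t (ks i)) chis Ds xbar ->
  KKT_point F xbar.
Proof.
move=> mf st cs [cx _ th0 cchi cD].
have [c c1 hc] := hA5; have c_gt0 : 0 < c by lra.
have [e [edot [L [_ _ _ hused _]]]] := hA3.
have [_ hst _ _ _] := hrun.
have good i : good_model F t (ks i) (Ds i) e edot L (m i).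
  by have [um _ _ _ _] := cs i; exact: hused.
have D_gt0 i : 0 < Ds i by have [_ _ /andP[]] := cs i.
have sD i : tr_norm t (ks i) (ss i) <= Ds i.
  by have [_ [_ cp] _ _ _] := cs i; exact: compatible_le hp (D_gt0 i) cp.
have ballC i y : tr_ball t (ks i) (Ds i) y -> Cset t y.
  move=> yD; exists (ks i); first exact: st.
  by have [_ _ /andP[_ Dr] _ _] := cs i; apply: le_trans yD Dr.
have xball i : tr_ball t (ks i) (Ds i) (iter_x t (ks i)).
  (* That the norm vanishes at 0 is obtained from homogeneity with factor 0. *)
  rewrite /tr_ball /= subrr -(scale0r 0).
  have [[_ NZ _] _ _] := hst _ (st i).
  by rewrite NZ normr0 mul0r ltW.
have yball i : tr_ball t (ks i) (Ds i) (iter_x t (ks i) + ss i).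
  by rewrite /tr_ball /= addrC addKr.
have cs0 : ss i @[i --> \oo] --> (0 : 'rV[R]_n).
  apply: (@cvg_of_enorm_le _ _ _ Ds c) => // i.
  have [/andP[_ le] _] := hc _ (st i) (ss i).
  by apply: le_trans le _; rewrite ler_pM2l.
have cy : iter_x t (ks i) + ss i @[i --> \oo] --> xbar.
  by rewrite -[X in _ --> X]addr0; exact: cvgD.
have [Fo Fh Fg] := hF.
have C1 phi : C2_on setT phi -> differentiable phi xbar /\
    {for xbar, continuous (grad phi)} by case=> /(_ xbar I).
apply: (@KKT_of_vanishing_criticality _ _ _ _ _ F xbar
  (fun i => iter_x t (ks i)) ss m (fun i => pb_norm t (ks i)) c chis) => //.
- exact: theta0_feasible.
- move=> i d; have [_ /andP[le _]] := hc _ (st i) d.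
  by rewrite -ler_pdivrMl.
- move=> l; have [_ cg] := C1 _ (Fo l).
  apply: (@mx_cvg_model_grad _ _ _ _ _ t e edot L _ _ ks Ds) => // i.
    by have [[]] := good i.
  exact: ballC (yball i).
- move=> l; have [_ cg] := C1 _ (Fh l).
  apply: (@mx_cvg_model_grad _ _ _ _ _ t e edot L _ _ ks Ds) => // i.
    by have [[]] := good i.
  exact: ballC (xball i).
- move=> l; have [_ cg] := C1 _ (Fg l).
  apply: (@mx_cvg_model_grad _ _ _ _ _ t e edot L _ _ ks Ds) => // i.
    by have [[]] := good i.
  exact: ballC (xball i).
- move=> l; have [dg _] := C1 _ (Fg l).
  (* Interpolation at the iterate replaces surrogate values by true ones. *)
  have -> : (fun i => ineq (m i) l (iter_x t (ks i))) =
      (fun i => ineq F l (iter_x t (ks i))).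
    by apply/funext => i; have [_ [_ _ ->]] := good i.
  exact: (@cvg_comp _ _ _ (fun i => iter_x t (ks i)) (ineq F l) _ _ _ cx
    (differentiable_continuous dg)).
- exact: mx_cvg_of_cvg.
- by move=> i; have [_ [[]]] := cs i.
- move=> i beta d tf; have [_ _ _ [d0 tm] ->] := cs i.
  exact: crit_measure_ge tm tf.
Qed.

(** * The outer and inner quasi-stationary sequences *)

Theorem theorem4 (R : realType) (n K M P : nat) (F : functions R n K M P)
    (p : constants R) (t : run_data R n K M P)
    (hF : each (C2_on setT) F)
    (hp : constants_ok p)
    (hrun : algorithm_run F p t)
    (hA1 : A1 p t) (hA2 : A2 F t) (hA3 : A3 F p t) (hA4 : A4 F p t)
    (hA5 : A5 t) (hA6 : A6 t) (hA7 : A7 p t) (hA8 : A8 t)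
    (xbar : 'rV[R]_n)
    (hqs : quasi_stationary F p t xbar)
    (hmfcq : MFCQ F xbar) :
  KKT_point F xbar.
Proof.
case: hqs => [[stop0 [ks [_ nres [cx cth th0 cchi cD]]]]|
    [k [stopk [nres ct hpass] [cx cth th0 cchi cD]]]].
  have st i : started t (ks i) by rewrite /started stop0.
  have step i : {msD : functions R n K M P * 'rV[R]_n * R |
      critical_step F p t (ks i) msD.1.1 msD.1.2 msD.2 (chi t (ks i)) /\
      msD.2 <= Defs.radius t (ks i)}.
    apply: cid; have [|m [s [D mD]]] := critical_step_completed _ _ _ hp hrun hA1 (ks i) _ (nres i).
      by rewrite /completed stop0.
    by exists (m, s, D).
  apply: (KKT_of_critical_steps _ _ _ _ _ F p t hF hp hrun hA1 hA3 hA5 xbar ks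
    (fun i => (sval (step i)).1.1) (fun i => (sval (step i)).1.2)
    (fun i => (sval (step i)).2) (fun i => chi t (ks i)) hmfcq st).
    by move=> i; case: (svalP (step i)).
  split => //.
  (* The radii of the chosen surrogates lie between 0 and the final radii. *)
  apply: (@squeeze_cvgr _ _ _ _ (fun=> 0) (fun i => Defs.radius t (ks i))) => //.
    near=> i; have [[_ _ /andP[/ltW-> _] _ _] ->] := svalP (step i); done.
  exact: cvg_cst.
(* Endless routine: the iterate is constant and the sequence index is the pass counter. *)
have st : started t k by rewrite /started stopk.
apply: (KKT_of_critical_steps _ _ _ _ _ F p t hF hp hrun hA1 hA3 hA5 xbar (fun=> k)
  (cr_mod t k) (cr_nstep t k) (cr_rad t k) (cr_chi t k) hmfcq) => //.
by move=> j; exact: critical_step_cr.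
Unshelve. all: by end_near. Qed.
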